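(* For every $A\in\mathrm{PSL}_q(2,\mathbb Z)$, the trace $\operatorname{tr}A$ is equivalent to one of the following polynomials: (1) $1+q^n$ for some $n\in\mathbb Z_{\ge0}$; (2) $[n]_q$ for some $n\in\mathbb Z_{\ge 0}$ (where $[0]_q=0$); (3) $\operatorname{tr}M_q(a_1,\ldots,a_{2m})$ for some integers $a_1,\ldots,a_{2m}>0$.
   Context: Let $q$ be a formal parameter, $R_q=\begin{pmatrix} q&1\\0&1\end{pmatrix}$, $S_q=\begin{pmatrix}0&-q^{-1}\\1&0\end{pmatrix}$ and $L_q=q^{-1}R_qS_qR_q=\begin{pmatrix}1&0\\1&q^{-1}\end{pmatrix}$. The subgroup $\langle R_q,S_q\rangle\subset\mathrm{GL}(2,\mathbb Z[q^{\pm1}])$ contains $\pm q^{\pm1}\mathrm{Id}$, and $\mathrm{PSL}_q(2,\mathbb Z):=\langle R_q,S_q\rangle/\{\pm q^n\mathrm{Id}\mid n\in\mathbb Z\}$. Elements are represented by matrices defined up to multiplication by $\pm q^n$, so the trace of an element is defined up to multiplication by $\pm q^n$. $M_q(a_1,\ldots,a_{2m}):=R_q^{a_1}L_q^{a_2}R_q^{a_3}L_q^{a_4}\cdots R_q^{a_{2m-1}}L_q^{a_{2m}}$. The $q$-integer is $[n]_q=\frac{1-q^n}{1-q}$. For $f,g\in\mathbb Z[q^{\pm1}]$, $f$ is equivalent to $g$ if $f=\pm q^ng$ for some $n\in\mathbb Z$ and some sign. *)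

(* Defs.v *)
From HB Require Import structures.
From mathcomp Require Import all_boot all_order all_algebra.
From mathcomp Require Import ring.

Set Implicit Arguments.
Unset Strict Implicit.
Unset Printing Implicit Defensive.

Import GRing.Theory.
Local Open Scope ring_scope.

(* Laurent polynomials in q live in the fraction field of Z[q]: this contains
   Z[q^{+-1}] (predicate [laurent]) and gives (1 - q^n) / (1 - q) its literal
   meaning.  [RSgroup_laurent] shows that the subgroup generated by R_q and S_q
   stays within the matrices over Z[q^{+-1}], so it does not depend on whether
   it is formed in GL_2 of the fraction field or of Z[q^{+-1}]. *)
Notation Kq := {fraction {poly int}}.

Definition q : Kq := tofrac 'X.

Definition laurent (x : Kq) : Prop :=
  exists (n : nat) (p : {poly int}), x * q ^+ n = tofrac p.

Definition mx2 (K : fieldType) (a b c d : K) : 'M[K]_2 :=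
  \matrix_(i, j) if i == 0 then (if j == 0 then a else b)
                 else (if j == 0 then c else d).

Definition Rq : 'M[Kq]_2 := mx2 q 1 0 1.
Definition Sq : 'M[Kq]_2 := mx2 0 (- q^-1) 1 0.
Definition Lq : 'M[Kq]_2 := q^-1 *: (Rq * Sq * Rq).

(* The subgroup <R_q, S_q>.  On invertible matrices, as here, [^-1] is the
   matrix inverse. *)
Inductive RSgroup : 'M[Kq]_2 -> Prop :=
| RSgroup_R : RSgroup Rq
| RSgroup_S : RSgroup Sq
| RSgroup_1 : RSgroup 1
| RSgroup_mul A B : RSgroup A -> RSgroup B -> RSgroup (A * B)
| RSgroup_inv A : RSgroup A -> RSgroup A^-1.

(* Elements of the quotient <R_q, S_q> / {+-q^n Id}, as cosets. *)
Record PSLq := MkPSLq {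
  PSLq_coset :> 'M[Kq]_2 -> Prop;
  PSLq_cosetP : exists2 A, RSgroup A & forall B,
    PSLq_coset B <-> exists (s : bool) (n : int), B = ((-1) ^+ s * q ^ n) *: A
}.

Definition equivq (f g : Kq) : Prop :=
  exists (s : bool) (n : int), f = (-1) ^+ s * q ^ n * g.

Definition qint (n : nat) : Kq := (1 - q ^+ n) / (1 - q).

(* M_q(a_1, ..., a_{2m}); only the values a 1, ..., a (2 * m) matter. *)
Definition Mq (m : nat) (a : nat -> nat) : 'M[Kq]_2 :=
  \prod_(1 <= i < m.+1) (Rq ^+ a (2 * i - 1)%N * Lq ^+ a (2 * i)%N).

Lemma q_neq0 : q != 0.
Proof. by rewrite /q tofrac_eq0 polyX_eq0. Qed.

Lemma subr1q_neq0 : 1 - q != 0.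
Proof.
rewrite subr_eq0 /q -tofrac1 tofrac_eq; apply/eqP=> /(congr1 (fun p : {poly int} => p`_0)).
by rewrite coefC coefX.
Qed.

Lemma mulmx2 (K : fieldType) (a b c d a' b' c' d' : K) :
  mx2 a b c d * mx2 a' b' c' d' =
  mx2 (a * a' + b * c') (a * b' + b * d') (c * a' + d * c') (c * b' + d * d').
Proof.
apply/matrixP => i j; rewrite !mxE big_ord_recl big_ord1 !mxE /=.
by case: ifP; case: ifP.
Qed.

Lemma mx2_RSR (K : fieldType) (x : K) : x != 0 ->
  x^-1 *: (mx2 x 1 0 1 * mx2 0 (- x^-1) 1 0 * mx2 x 1 0 1) = mx2 1 0 1 x^-1.
Proof.
move=> x0; rewrite !mulmx2; apply/matrixP => i j; rewrite !mxE.
by case: ifP; case: ifP => _ _; field.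
Qed.

Lemma LqE : Lq = mx2 1 0 1 q^-1.
Proof. exact: mx2_RSR q_neq0. Qed.

Lemma det_mx2M (K : fieldType) (a b c d a' b' c' d' : K) :
  (a * a' + b * c') * (c * b' + d * d') - (a * b' + b * d') * (c * a' + d * c')
  = (a * d - b * c) * (a' * d' - b' * c').
Proof. by ring. Qed.

Lemma laurentD x y : laurent x -> laurent y -> laurent (x + y).
Proof.
move=> [n [p xp]] [m [r yr]]; exists (n + m)%N, (p * 'X^m + r * 'X^n).
rewrite tofracD !tofracM !tofracXn -xp -yr exprD -/q mulrDl !mulrA.
by congr (_ + _); rewrite mulrAC.
Qed.

Lemma laurentM x y : laurent x -> laurent y -> laurent (x * y).
Proof.
move=> [n [p xp]] [m [r yr]]; exists (n + m)%N, (p * r).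
by rewrite tofracM -xp -yr exprD mulrACA.
Qed.

Lemma laurent_poly (p : {poly int}) : laurent (tofrac p).
Proof. by exists 0%N, p; rewrite mulr1. Qed.

Lemma laurentN x : laurent x -> laurent (- x).
Proof. by move=> [n [p xp]]; exists n, (- p); rewrite tofracN -xp mulNr. Qed.

Lemma laurent0 : laurent 0. Proof. by rewrite -tofrac0; exact: laurent_poly. Qed.
Lemma laurent1 : laurent 1. Proof. by rewrite -tofrac1; exact: laurent_poly. Qed.
Lemma laurentq : laurent q. Proof. exact: laurent_poly. Qed.
Lemma laurentqV : laurent q^-1.
Proof. by exists 1%N, 1; rewrite expr1 mulVf ?q_neq0 // tofrac1. Qed.

Lemma laurentqz (n : int) : laurent (q ^ n).
Proof.
have lX x k : laurent x -> laurent (x ^+ k).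
  move=> lx; elim: k => [|k IH]; first by rewrite expr0; exact: laurent1.
  by rewrite exprS; exact: laurentM.
case: n => n; first exact: lX laurentq.
by rewrite NegzE -exprz_inv; exact: lX laurentqV.
Qed.

Lemma laurent_mx2 a b c d : laurent a -> laurent b -> laurent c -> laurent d ->
  forall i j, laurent (mx2 a b c d i j).
Proof. by move=> *; rewrite mxE; case: ifP; case: ifP. Qed.

Lemma mx2E (K : fieldType) (A : 'M[K]_2) : A = mx2 (A 0 0) (A 0 1) (A 1 0) (A 1 1).
Proof.
have I2 (i : 'I_2) : i = if i == 0 then 0 else 1.
  by case: i => [[|[|]]] // ?; apply/val_inj.
apply/matrixP => i j; rewrite mxE {1}(I2 i) {1}(I2 j).
by case: ifP; case: ifP.
Qed.

Lemma mx21 (K : fieldType) : mx2 1 0 0 1 = 1 :> 'M[K]_2.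
Proof. by rewrite [RHS]mx2E !mxE. Qed.

Lemma mx2V (K : fieldType) (a b c d : K) : a * d - b * c != 0 ->
  let e := (a * d - b * c)^-1 in
  mx2 a b c d \is a GRing.unit /\
  (mx2 a b c d)^-1 = mx2 (e * d) (- (e * b)) (- (e * c)) (e * a).
Proof.
move=> D0 e; set A := mx2 a b c d; set B := mx2 (e * d) _ _ _.
have AB : A * B = 1.
  by rewrite mulmx2 -mx21 /e; congr mx2; field.
have uA : A \is a GRing.unit by case/mulmx1_unit: AB.
by split=> //; rewrite -[LHS]mulr1 -AB mulKr.
Qed.

Lemma det_mx2V (K : fieldType) (a b c d e : K) :
  (e * d) * (e * a) - - (e * b) * - (e * c) = e * (e * (a * d - b * c)).
Proof. by ring. Qed.

Lemma RSgroup_laurent A : RSgroup A ->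
  (forall i j, laurent (A i j)) /\
  exists n : int, A 0 0 * A 1 1 - A 0 1 * A 1 0 = q ^ n.
Proof.
have q0 := q_neq0.
elim=> {A} [|||A B _ [lA [n An]] _ [lB [m Bm]]|A _ [lA [n An]]].
- split; first by apply: laurent_mx2;
    [exact: laurentq|exact: laurent1|exact: laurent0|exact: laurent1].
  by exists 1; rewrite !mxE /= expr1z mulr1 mulr0 subr0.
- split; first by apply: laurent_mx2;
    [exact: laurent0|apply/laurentN/laurentqV|exact: laurent1|exact: laurent0].
  by exists (-1); rewrite !mxE /= exprN1 mulr0 mulr1 sub0r opprK.
- split; last by exists 0; rewrite !mxE /= expr0z mulr1 mulr0 subr0.
  by rewrite -mx21; apply: laurent_mx2;
    [exact: laurent1|exact: laurent0|exact: laurent0|exact: laurent1].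
- rewrite (mx2E A) (mx2E B) mulmx2; split.
    by apply: laurent_mx2; apply: laurentD; apply: laurentM.
  by exists (n + m); rewrite expfzDr // -An -Bm -det_mx2M !mxE.
- have D0 : A 0 0 * A 1 1 - A 0 1 * A 1 0 != 0 by rewrite An expfz_neq0.
  have [_] := mx2V D0; rewrite -mx2E => ->; rewrite An invr_expz; split.
    by apply: laurent_mx2; do ?apply: laurentN; apply: laurentM;
      (exact: laurentqz || exact: lA).
  exists (- n); rewrite ![mx2 _ _ _ _ _ _]mxE /= det_mx2V An -invr_expz.
  by rewrite mulVf ?expfz_neq0 ?mulr1.
Qed.

Lemma RSgroup_unit A : RSgroup A -> A \is a GRing.unit.
Proof.
case/RSgroup_laurent=> _ [n An]; rewrite (mx2E A).
by case: (@mx2V _ (A 0 0) (A 0 1) (A 1 0) (A 1 1)); rewrite ?An ?expfz_neq0 ?q_neq0.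
Qed.

Lemma mx2_SS (K : fieldType) (x : K) :
  mx2 0 (- x^-1) 1 0 * mx2 0 (- x^-1) 1 0 = (- x^-1) *: 1.
Proof.
rewrite mulmx2 -mx21; apply/matrixP => i j; rewrite !mxE.
by case: ifP; case: ifP => _ _; ring.
Qed.

Lemma mx2_RS3 (K : fieldType) (x : K) : x != 0 ->
  (mx2 x 1 0 1 * mx2 0 (- x^-1) 1 0) ^+ 3 = - 1.
Proof.
move=> x0; rewrite !exprS expr0 mulr1 !mulmx2 -mx21.
apply/matrixP => i j; rewrite !mxE.
by case: ifP; case: ifP => _ _; field.
Qed.

(* The normal subgroup is indeed contained in <R_q, S_q>, so the cosets of
   [PSLq] consist of elements of <R_q, S_q>. *)
Lemma RSgroup_scalar (s : bool) (n : int) :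
  RSgroup (((-1) ^+ s * q ^ n) *: 1).
Proof.
have N1 : RSgroup (- 1).
  rewrite -(mx2_RS3 q_neq0) !exprS expr0 mulr1.
  by repeat apply: RSgroup_mul; (exact: RSgroup_R || exact: RSgroup_S).
have qV : RSgroup (q^-1 *: 1).
  have -> : q^-1 *: 1 = (- 1) * (Sq * Sq).
    by rewrite mx2_SS mulNr mul1r scaleNr opprK.
  by apply: RSgroup_mul => //; apply: RSgroup_mul; exact: RSgroup_S.
have q1 : RSgroup (q *: 1).
  have -> : q *: 1 = (q^-1 *: 1 : 'M[Kq]_2)^-1.
    by rewrite invrZ ?unitr1 ?unitfE ?invr_eq0 ?q_neq0 // invrK invr1.
  exact: RSgroup_inv.
have RSX A k : RSgroup A -> RSgroup (A ^+ k).
  move=> RA; elim: k => [|k IH]; first exact: RSgroup_1.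
  by rewrite exprS; exact: RSgroup_mul.
rewrite -scalerA -[_ *: 1]mul1r scalerAl; apply: RSgroup_mul.
  by case: s; rewrite ?expr0 ?expr1 ?scaleN1r ?scale1r //; exact: RSgroup_1.
case: n => n; rewrite ?NegzE -?exprz_inv.
  by rewrite -[1](expr1n _ n) -exprZn; exact: RSX.
by rewrite -[1](expr1n _ n.+1) -exprZn; exact: RSX.
Qed.

Lemma PSLq_sub (A : PSLq) M : A M -> RSgroup M.
Proof.
case: A => C [A RA CE] /CE[s [n ->]].
by rewrite -[A]mul1r scalerAl; apply: RSgroup_mul => //; exact: RSgroup_scalar.
Qed.

(* Main.v *)
Require Import Defs.
From mathcomp Require Import all_boot all_order all_algebra.
From mathcomp Require Import ring.

(** In the modular group, with S of order two and U = RS of order three, both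
    R = US and L = U^-1 S.  Hence a letter R or L, then S, then again a letter
    R or L, always collapses, up to a factor +-q^n, to one letter:
      RSR ~ L,   LSL ~ R,   RSL ~ LSR ~ S   ([letter_collapse]).
    These rules together with S^2 ~ 1 give R^-1 ~ SLS, so every element of the
    group is a positive word in R, L and S ([RSgroup_word]).

    The trace depends only on the cyclic word, and a cyclic word of length at
    least three that contains S can be shortened around that S.  The process
    ends ([good_tr_word]) either with a word of length at most two containing
    S, whose trace is equivalent to 0 = [0], 1 = [1] or 2 = 1 + q^0, or with a
    word in R and L alone.  Such a word is a power of R or of L, of trace
    equivalent to 1 + q^n, or else it is cyclically a product of blocks R^a L^b
    with a, b > 0 ([word_false_shape]), which is the third family. *)

Set Implicit Arguments.
Unset Strict Implicit.
Unset Printing Implicit Defensive.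

Import GRing.Theory.
Local Open Scope ring_scope.

(** * Equality up to a factor +-q^n *)

Definition is_pmq (c : Kq) : Prop := exists (s : bool) (n : int), c = (-1) ^+ s * q ^ n.

Lemma is_pmq_expz n : is_pmq (q ^ n).
Proof. by exists false, n; rewrite mul1r. Qed.

Lemma is_pmqN c : is_pmq c -> is_pmq (- c).
Proof.
by move=> [s [n ->]]; exists (~~ s), n; rewrite -mulNr; case: s; rewrite ?opprK.
Qed.

Lemma is_pmq1 : is_pmq 1. Proof. exact: (is_pmq_expz 0). Qed.

Lemma is_pmqM c d : is_pmq c -> is_pmq d -> is_pmq (c * d).
Proof.
move=> [s [n ->]] [t [m ->]]; exists (s (+) t), (n + m).
by rewrite mulrACA signr_addb expfzDr ?q_neq0.
Qed.

Lemma is_pmqV c : is_pmq c -> is_pmq c^-1.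
Proof.
move=> [s [n ->]]; exists s, (- n).
by rewrite invfM invr_expz; case: s; rewrite ?expr1 ?invrN1 ?expr0 ?invr1.
Qed.

Lemma is_pmq_neq0 c : is_pmq c -> c != 0.
Proof. by move=> [s [n ->]]; rewrite mulf_neq0 ?signr_eq0 ?expfz_neq0 ?q_neq0. Qed.

Definition sim (A B : 'M[Kq]_2) : Prop := exists2 c, is_pmq c & A = c *: B.

Lemma sim_refl A : sim A A.
Proof. by exists 1; [exact: is_pmq1 | rewrite scale1r]. Qed.

Lemma simM A A' B B' : sim A A' -> sim B B' -> sim (A * B) (A' * B').
Proof.
move=> [c c1 ->] [d d1 ->]; exists (c * d); first exact: is_pmqM.
by rewrite -scalerAl -scalerAr scalerA.
Qed.

Lemma sim_invl A B : A \is a GRing.unit -> sim (A * B) 1 -> sim A^-1 B.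
Proof.
move=> uA [c c1 AB]; exists c^-1; first exact: is_pmqV.
by rewrite -(mulKr uA B) AB -scalerAr mulr1 scalerA mulVf ?scale1r ?is_pmq_neq0.
Qed.

Lemma equivq_pmq f g c : is_pmq c -> f = c * g -> equivq f g.
Proof. by move=> [s [n ->]] ->; exists s, n. Qed.

Lemma equivq_trans g f h : equivq f g -> equivq g h -> equivq f h.
Proof.
move=> [s [n ->]] [t [m ->]].
apply: (@equivq_pmq _ _ ((-1) ^+ s * q ^ n * ((-1) ^+ t * q ^ m))).
  by apply: is_pmqM; [exists s, n | exists t, m].
by rewrite !mulrA.
Qed.

Lemma sim_tr A B : sim A B -> equivq (\tr A) (\tr B).
Proof. by move=> [c c1 ->]; apply: (equivq_pmq c1); rewrite mxtraceZ. Qed.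

Definition good (t : Kq) : Prop :=
  (exists n : nat, equivq t (1 + q ^+ n)) \/
  (exists n : nat, equivq t (qint n)) \/
  (exists (m : nat) (a : nat -> nat),
      (0 < m)%N /\
      (forall i : nat, (1 <= i <= 2 * m)%N -> (0 < a i)%N) /\
      equivq t (\tr (Mq m a))).

Lemma good_equivq f g : equivq f g -> good g -> good f.
Proof.
move=> fg [[n gn]|[[n gn]|[m [a [m0 [a0 ga]]]]]].
- by left; exists n; apply: equivq_trans gn.
- by right; left; exists n; apply: equivq_trans gn.
- by right; right; exists m, a; do !split=> //; apply: equivq_trans ga.
Qed.

(** * Words in R, L and S *)

(** [Some true], [Some false] and [None] stand for R, L and S, so that the
    words in R and L alone are the images under [Some] of boolean words. *)
Definition letter_mx (x : option bool) : 'M[Kq]_2 :=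
  match x with Some true => Rq | Some false => Lq | None => Sq end.

Definition word (v : seq (option bool)) : 'M[Kq]_2 := \prod_(x <- v) letter_mx x.

Lemma word_cons x v : word (x :: v) = letter_mx x * word v.
Proof. exact: big_cons. Qed.

Lemma word_cat u v : word (u ++ v) = word u * word v.
Proof. exact: big_cat. Qed.

Lemma word1 x : word [:: x] = letter_mx x.
Proof. exact: big_seq1. Qed.

Lemma tr_mulC (A B : 'M[Kq]_2) : \tr (A * B) = \tr (B * A).
Proof. exact: mxtrace_mulC. Qed.

Lemma tr_word_catC u v : \tr (word (u ++ v)) = \tr (word (v ++ u)).
Proof. by rewrite !word_cat tr_mulC. Qed.

Lemma tr_mx2 (x y z t : Kq) : \tr (mx2 x y z t) = x + t.
Proof. by rewrite /mxtrace big_ord_recl big_ord1 !mxE. Qed.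

(** * The collapsing rules *)

Lemma is_pmqVq : is_pmq q^-1.
Proof. by rewrite -exprN1; exact: is_pmq_expz. Qed.

Lemma sim_SS : sim (Sq * Sq) 1.
Proof.
exists (- q^-1); last exact: mx2_SS.
exact/is_pmqN/is_pmqVq.
Qed.

Lemma sim_SSl A : sim (Sq * Sq * A) A.
Proof. by rewrite -{2}[A]mul1r; apply: simM sim_SS (sim_refl A). Qed.

Lemma sim_SSr A : sim (A * Sq * Sq) A.
Proof. by rewrite -mulrA -{2}[A]mulr1; apply: simM (sim_refl A) sim_SS. Qed.

Lemma sim_RSR : sim (Rq * Sq * Rq) Lq.
Proof.
exists q; first exact: (is_pmq_expz 1).
by rewrite /Lq scalerA mulfV ?scale1r ?q_neq0.
Qed.

(** The matrix identities are computed over an arbitrary field: normalising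
   field expressions in the concrete field of fractions would unfold it. *)
Lemma mx2_LSL (K : fieldType) (x : K) : x != 0 ->
  mx2 1 0 1 x^-1 * mx2 0 (- x^-1) 1 0 * mx2 1 0 1 x^-1 =
  (- (x^-1 * x^-1)) *: mx2 x 1 0 1.
Proof.
move=> x0; rewrite !mulmx2; apply/matrixP => i j; rewrite !mxE.
by case: ifP; case: ifP => _ _; field.
Qed.

Lemma mx2_RSL (K : fieldType) (x : K) : x != 0 ->
  mx2 x 1 0 1 * mx2 0 (- x^-1) 1 0 * mx2 1 0 1 x^-1 = mx2 0 (- x^-1) 1 0.
Proof. by move=> x0; rewrite !mulmx2; congr mx2; field. Qed.

Lemma mx2_LSR (K : fieldType) (x : K) : x != 0 ->
  mx2 1 0 1 x^-1 * mx2 0 (- x^-1) 1 0 * mx2 x 1 0 1 = mx2 0 (- x^-1) 1 0.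
Proof. by move=> x0; rewrite !mulmx2; congr mx2; field. Qed.

Lemma sim_LSL : sim (Lq * Sq * Lq) Rq.
Proof.
rewrite LqE; exists (- (q^-1 * q^-1)); last exact: mx2_LSL q_neq0.
exact/is_pmqN/is_pmqM/is_pmqVq/is_pmqVq.
Qed.

Lemma RSL : Rq * Sq * Lq = Sq.
Proof. by rewrite LqE; exact: mx2_RSL q_neq0. Qed.

Lemma LSR : Lq * Sq * Rq = Sq.
Proof. by rewrite LqE; exact: mx2_LSR q_neq0. Qed.

(** Allowing S among the outer letters as well makes the shortening of a
    cyclic word uniform: any S in it absorbs both of its neighbours. *)
Lemma letter_collapse x y :
  exists z, sim (letter_mx x * Sq * letter_mx y) (letter_mx z).
Proof.
case: x => [b|]; last by exists y; exact: sim_SSl.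
case: y => [c|]; last by exists (Some b); exact: sim_SSr.
case: b; case: c => /=.
- by exists (Some false); exact: sim_RSR.
- by exists None; rewrite RSL; exact: sim_refl.
- by exists None; rewrite LSR; exact: sim_refl.
- by exists (Some true); exact: sim_LSL.
Qed.

(** * Positive words represent the whole group *)

(** A word for the inverse is carried along because the inverse of a positive
    word is not visibly a positive word. *)
Lemma RSgroup_word A : RSgroup A ->
  (exists v, sim A (word v)) /\ (exists v, sim A^-1 (word v)).
Proof.
elim=> {A} [|||A B RA [[u Au] [u' Au']] RB [[v Bv] [v' Bv']]|A _ [Av Av']].
- split; first by exists [:: Some true]; rewrite word1; exact: sim_refl.
  exists [:: None; Some false; None].
  rewrite !word_cons [word nil]big_nil mulr1.
  apply: sim_invl; first exact/RSgroup_unit/RSgroup_R.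
  by rewrite /= !mulrA RSL; exact: sim_SS.
- split; exists [:: None]; rewrite word1; first exact: sim_refl.
  apply: sim_invl; [exact/RSgroup_unit/RSgroup_S | exact: sim_SS].
- by rewrite invr1; split; exists [::]; rewrite /word big_nil; exact: sim_refl.
- split; first by exists (u ++ v); rewrite word_cat; exact: simM.
  exists (v' ++ u'); rewrite word_cat invrM ?RSgroup_unit //; exact: simM.
- by rewrite invrK.
Qed.

(** * Traces of words in R and L *)

Lemma mx2_upper_expn (K : fieldType) (x : K) n :
  exists y, mx2 x 1 0 1 ^+ n = mx2 (x ^+ n) y 0 1.
Proof.
elim: n => [|n [y IH]]; first by exists 0; rewrite !expr0 mx21.
exists (x * y + 1); rewrite exprS IH mulmx2.
by congr mx2; rewrite ?exprS; ring.
Qed.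

Lemma mx2_lower_expn (K : fieldType) (x : K) n :
  exists z, mx2 1 0 1 x ^+ n = mx2 1 0 z (x ^+ n).
Proof.
elim: n => [|n [z IH]]; first by exists 0; rewrite !expr0 mx21.
exists (1 + x * z); rewrite exprS IH mulmx2.
by congr mx2; rewrite ?exprS; ring.
Qed.

Lemma good_tr_Rq_expn n : good (\tr (Rq ^+ n)).
Proof.
rewrite /Rq; have [y ->] := mx2_upper_expn q n; rewrite tr_mx2; left; exists n.
by apply: (equivq_pmq is_pmq1); rewrite mul1r addrC.
Qed.

Lemma good_tr_Lq_expn n : good (\tr (Lq ^+ n)).
Proof.
rewrite LqE; have [z ->] := mx2_lower_expn q^-1 n; rewrite tr_mx2; left; exists n.
apply: (equivq_pmq (is_pmq_expz (- n%:Z))).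
by rewrite -exprnN -exprVn mulrDr mulr1 -exprMn mulVf ?q_neq0 // expr1n addrC.
Qed.

(** The exponents are stored minus one, which builds positivity in. *)
Definition blocks (s : seq (nat * nat)) : 'M[Kq]_2 :=
  \prod_(p <- s) (Rq ^+ p.1.+1 * Lq ^+ p.2.+1).

Lemma blocks_cons p s : blocks (p :: s) = Rq ^+ p.1.+1 * Lq ^+ p.2.+1 * blocks s.
Proof. exact: big_cons. Qed.

Lemma blocks_rcons s p : blocks (rcons s p) = blocks s * (Rq ^+ p.1.+1 * Lq ^+ p.2.+1).
Proof. by rewrite /blocks -cats1 big_cat big_seq1. Qed.

Lemma good_tr_blocks p s : good (\tr (blocks (p :: s))).
Proof.
pose a i := let p := nth (0, 0)%N (p :: s) i.-1./2 in
  if odd i then p.1.+1 else p.2.+1.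
right; right; exists (size (p :: s)), a; split=> //; split.
  by move=> i _; rewrite /a /=; case: ifP.
suff -> : blocks (p :: s) = Mq (size (p :: s)) a.
  by apply: (equivq_pmq is_pmq1); rewrite mul1r.
rewrite /blocks (big_nth (0, 0)%N) /Mq big_add1 /=.
apply: eq_bigr => i _; rewrite /a mul2n doubleS subn1 /= odd_double /=.
by rewrite doubleK uphalf_double.
Qed.

Lemma mulR_blocks p s : exists p', Rq * blocks (p :: s) = blocks (p' :: s).
Proof. by exists (p.1.+1, p.2); rewrite !blocks_cons !mulrA -exprS. Qed.

Lemma blocks_mulL s p j : blocks (rcons s p) * Lq ^+ j = blocks (rcons s (p.1, p.2 + j)%N).
Proof. by rewrite !blocks_rcons -!mulrA -exprD addSn. Qed.

(** Ending with L leaves no incomplete block on the right, so that reading the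
    word from right to left only has to keep track of the leading power of L. *)
Lemma word_false_shape w :
  (exists j, word (map Some (rcons w false)) = Lq ^+ j.+1) \/
  (exists j p s, word (map Some (rcons w false)) = Lq ^+ j * blocks (p :: s)).
Proof.
elim: w => [|b w IH]; first by left; exists 0%N; rewrite word1.
rewrite rcons_cons map_cons word_cons; case: b => /=.
  right; exists 0%N; case: IH => [[j ->]|[[|j] [p [s ->]]]].
  - exists (0, j)%N, [::].
    by rewrite mul1r blocks_cons [blocks nil]big_nil mulr1.
  - by have [p' E] := mulR_blocks p s; exists p', s; rewrite !mul1r.
  - by exists (0, j)%N, (p :: s); rewrite mul1r [RHS]blocks_cons mulrA.
case: IH => [[j ->]|[j [p [s ->]]]]; first by left; exists j.+1; rewrite -exprS.
by right; exists j.+1, p, s; rewrite mulrA -exprS.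
Qed.

Lemma good_tr_RLword w : good (\tr (word (map Some w))).
Proof.
have [|wR] := boolP (false \in w).
  case/splitPr=> w1 w2.
  rewrite map_cat map_cons -cat1s catA tr_word_catC -[[:: Some false]]/(map Some [:: false]).
  rewrite -!map_cat catA cats1.
  have [[j ->]|[j [p [s ->]]]] := word_false_shape (w2 ++ w1).
    exact: good_tr_Lq_expn.
  (* the leading power of L moves cyclically into the last block *)
  rewrite tr_mulC lastI blocks_mulL.
  by case: (belast p s) => [|p' s']; rewrite ?rcons_cons; exact: good_tr_blocks.
suff -> : word (map Some w) = Rq ^+ size w by exact: good_tr_Rq_expn.
elim: w wR => [|[] w IH] //= wR; first by rewrite /word big_nil.
by rewrite word_cons IH -?exprS.
Qed.

(** * Shortening a cyclic word around S *)

Lemma good_tr_S : good (\tr Sq).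
Proof.
right; left; exists 0%N; apply: (equivq_pmq is_pmq1).
by rewrite tr_mx2 /qint expr0 subrr mul0r mulr0 addr0.
Qed.

Lemma qint1 : qint 1 = 1.
Proof. by rewrite /qint expr1 mulfV ?subr1q_neq0. Qed.

Lemma good_tr_S_letter x : good (\tr (Sq * letter_mx x)).
Proof.
case: x => [[]|] /=.
- right; left; exists 1%N; rewrite qint1 mulmx2 tr_mx2.
  by apply: (equivq_pmq is_pmq1); rewrite !(mul0r, mulr0, mulr1, add0r, addr0).
- right; left; exists 1%N; rewrite qint1 LqE mulmx2 tr_mx2.
  by apply: (equivq_pmq (is_pmqN is_pmqVq)); rewrite !(mul0r, mulr0, mulr1, add0r, addr0).
- apply: good_equivq (sim_tr sim_SS) _.
  by rewrite -(expr0 Rq); exact: good_tr_Rq_expn.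
Qed.

Lemma good_tr_word v : good (\tr (word v)).
Proof.
have [n] := ubnP (size v); elim: n v => // n IH v /ltnSE size_v.
have [v_S|v_RL] := boolP (None \in v); last first.
  suff -> : v = map Some (pmap id v) by exact: good_tr_RLword.
  by elim: v v_RL {size_v} => [|[b|] v IHv] //= v_RL; rewrite -IHv.
case/splitPr: v_S size_v => v1 v2.
rewrite tr_word_catC size_cat addnC -size_cat cat_cons; move: (v2 ++ v1) => u.
case: u => [|x u]; first by rewrite word1 => _; exact: good_tr_S.
case/lastP: u => [|u y] size_u.
  by rewrite word_cons word1; exact: good_tr_S_letter.
have [z yx_z] := letter_collapse y x.
(* moving y to the front makes S the middle letter of y S x *)
apply: (@good_equivq _ (\tr (word (z :: u)))); last first.
  by apply: IH; move: size_u; rewrite /= size_rcons; apply: leq_trans.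
rewrite -cats1 -!cat_cons tr_word_catC; apply: sim_tr.
rewrite cat1s !word_cons !mulrA; exact: simM (sim_refl _).
Qed.

Theorem proposition4p9 (A : PSLq) (M : 'M[Kq]_2) (hM : A M) :
  (exists n : nat, equivq (\tr M) (1 + q ^+ n)) \/
  (exists n : nat, equivq (\tr M) (qint n)) \/
  (exists (m : nat) (a : nat -> nat),
      (0 < m)%N /\
      (forall i : nat, (1 <= i <= 2 * m)%N -> (0 < a i)%N) /\
      equivq (\tr M) (\tr (Mq m a))).
Proof.
have [[v Mv] _] := RSgroup_word (PSLq_sub hM).
exact: good_equivq (sim_tr Mv) (good_tr_word v).
Qed.
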